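(* Let $n\ge1$, $e\ge 0$ and $t>1$ be integers and $q=(2e+1)t$. If $C\in LPL^{\infty}(n,e,q)$ and $x\in t^{-1}C$, then $$\widetilde{C}=C\times\{0\}+(x,2e+1)\mathbb{Z}\ \in\ LPL^{\infty}(n+1,e,q).$$
   Context: For $a\in\mathbb{Z}_q$ with representative $\tilde a\in\{0,\dots,q-1\}$ put $|a|_1=\min\{\tilde a,q-\tilde a\}$. The maximum metric on $\mathbb{Z}_q^n$ is $d(x,y)=\max_i|x_i-y_i|_1$, and $B(x,r)=\{y\in\mathbb{Z}_q^n: d(x,y)\le r\}$. $LPL^{\infty}(n,e,q)$ is the set of linear perfect codes with packing radius $e$, i.e. of subgroups $C$ of $(\mathbb{Z}_q^n,+)$ with $\#C>1$ such that $\mathbb{Z}_q^n$ is the disjoint union of the balls $B(c,e)$, $c\in C$. For a subgroup $C$ of $\mathbb{Z}_q^n$, $t^{-1}C=\{g\in\mathbb{Z}_q^n: tg\in C\}$. $(x,2e+1)\mathbb{Z}$ denotes the subgroup of $\mathbb{Z}_q^{n+1}$ generated by $(x,2e+1)$. *)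

(* Defs.v *)
From mathcomp Require Import all_boot all_order all_algebra all_fingroup.

Set Implicit Arguments.
Unset Strict Implicit.
Unset Printing Implicit Defensive.

Import GRing.Theory.
Local Open Scope ring_scope.

(* The library type 'Z_q is the ring of integers modulo q only when 1 < q;
   every definition below is meant for such q. *)

Definition lee_weight (q : nat) (a : 'Z_q) : nat := minn a (q - a)%N.

Definition dist_max (n q : nat) (x y : 'rV['Z_q]_n) : nat :=
  \max_(i < n) lee_weight (x 0 i - y 0 i)%R.

Definition ball_max (n q : nat) (x : 'rV['Z_q]_n) (r : nat) :
    {set 'rV['Z_q]_n} :=
  [set y | (dist_max x y <= r)%N].

(* The finGroupType structure of 'rV['Z_q]_n is the additive one, so
   [group_set C] says that C is an additive subgroup. Disjointness is that of
   the family of balls indexed by C, not of the set of its members: distinct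
   codewords must have disjoint balls. *)
Definition LPL_infty (n e q : nat) (C : {set 'rV['Z_q]_n}) : Prop :=
  [/\ group_set C,
      (1 < #|C|)%N,
      \bigcup_(c in C) ball_max c e = [set: 'rV['Z_q]_n] &
      {in C &, forall c c', c != c' ->
         [disjoint ball_max c e & ball_max c' e]}].
Arguments LPL_infty : clear implicits.

Definition div_code (n q t : nat) (C : {set 'rV['Z_q]_n}) :
    {set 'rV['Z_q]_n} :=
  [set g | g *+ t \in C].

(* C x {0} + (x, a)Z; the cyclic subgroup <[_]> is again the additive one. *)
Definition ext_code (n q : nat) (C : {set 'rV['Z_q]_n})
    (x : 'rV['Z_q]_n) (a : 'Z_q) : {set 'rV['Z_q]_(n + 1)} :=
  [set u + v | u in [set row_mx c (0 : 'rV['Z_q]_1) | c in C],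
               v in <[row_mx x (const_mx a : 'rV['Z_q]_1)]>%g].

(* Main.v *)
Require Import Defs.
From mathcomp Require Import all_boot all_order all_algebra all_fingroup.
From mathcomp Require Import zify ring.

Set Implicit Arguments.
Unset Strict Implicit.
Unset Printing Implicit Defensive.

Import GRing.Theory.
Local Open Scope ring_scope.

(** The new coordinate runs over the multiples of [2 * e + 1] modulo
    [q = (2 * e + 1) * t], and these multiples form a one-dimensional perfect
    code: every residue lies within [e] of exactly one of them
    ([lee_weight_cover], [lee_weight_packing]).  A word [(y, s)] therefore
    determines the multiple [k * (2 * e + 1)] close to [s], that is, [k] modulo
    [t]; the words of the extended code over that multiple are the
    [(c + k x, k * (2 * e + 1))] with [c] in [C], where [k] may be any
    representative of its class modulo [t] precisely because [t x] lies in [C].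
    So, since the maximum metric splits over the coordinates
    ([mem_ball_max_row_mx]), covering and packing for [(y, s)] reduce to
    covering and packing of [y - k x] by the balls of [C]. *)

Lemma Zp_natr_eq q (m n : nat) :
  (1 < q)%N -> ((m%:R : 'Z_q) == n%:R) = (m == n %[mod q]).
Proof. by move=> q1; rewrite -val_eqE /= !val_Zp_nat. Qed.

(** Shifting by [e] turns the symmetric interval of residues of weight at most
    [e] into an initial segment of the naturals, so that questions about
    weights become questions about Euclidean division. *)
Lemma lee_weight_leP q e (b : 'Z_q) : (1 < q)%N -> (2 * e < q)%N ->
  (lee_weight b <= e)%N <-> exists2 i, (i <= 2 * e)%N & b + e%:R = i%:R.
Proof.
move=> q1 eq; rewrite /lee_weight geq_min; split=> [/orP[be|qbe]|[i ie bi]].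
- by exists (b + e)%N; [lia | rewrite natrD natr_Zp].
- have bq : (b < q)%N by rewrite -[X in (_ < X)%N](Zp_cast q1) ltn_ord.
  exists (b + e - q)%N; first by lia.
  have -> : b + e%:R = (b + e)%N%:R by rewrite natrD natr_Zp.
  by rewrite -[in LHS](@subnK q (b + e)) ?natrD ?pchar_Zp ?addr0 //; lia.
have -> : b = i%:R - e%:R by rewrite -bi addrK.
have [lei|lie] := leqP e i.
  by rewrite -natrB // val_Zp_nat // modn_small; lia.
(* A negative residue: its representative is [q] minus its weight. *)
have -> : i%:R - e%:R = (q + i - e)%N%:R :> 'Z_q.
  by rewrite natrB ?natrD ?pchar_Zp ?add0r //; lia.
by rewrite val_Zp_nat // modn_small; lia.
Qed.

Lemma lee_weight_cover q e (s : 'Z_q) : (1 < q)%N -> (2 * e < q)%N ->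
  exists k, (lee_weight ((2 * e + 1)%N%:R *+ k - s)%R <= e)%N.
Proof.
move=> q1 eq.
(* The quotient below rounds [s] to the nearest multiple of [2 * e + 1]. *)
move dE: (2 * e + 1)%N => d; exists ((s + e) %/ d)%N; apply/lee_weight_leP => //.
have rd : ((s + e) %% d < d)%N by rewrite ltn_mod -dE addn1.
have : (s + e)%N%:R = (d * ((s + e) %/ d) + (s + e) %% d)%N%:R :> 'Z_q.
  by rewrite mulnC -divn_eq.
rewrite natrD natr_Zp; move: (_ %/ d)%N (_ %% d)%N rd => k r rd.
rewrite natrD => /(canRL (addrK _)) ->.
exists (2 * e - r)%N; first by lia.
by rewrite natrB; [rewrite mulrnA; ring | lia].
Qed.

(** Two multiples of [d = 2 * e + 1] within [e] of the same residue differ by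
    less than [d] in absolute value, and [d] divides [q], so they coincide;
    dividing by [d] turns their congruence modulo [q] into one modulo [t]. *)
Lemma lee_weight_packing q e t (s : 'Z_q) (k l : nat) :
    (1 < q)%N -> q = ((2 * e + 1) * t)%N -> (0 < t)%N ->
    (lee_weight ((2 * e + 1)%N%:R *+ k - s)%R <= e)%N ->
    (lee_weight ((2 * e + 1)%N%:R *+ l - s)%R <= e)%N ->
  k = l %[mod t].
Proof.
move=> q1 qE t0; have eq : (2 * e < q)%N by rewrite qE; nia.
move=> /lee_weight_leP-/(_ q1 eq)[i ie Ei] /lee_weight_leP-/(_ q1 eq)[j je Ej].
set d := (2 * e + 1)%N in qE Ei Ej.
have /eqP : (d * k + j)%N%:R = (d * l + i)%N%:R :> 'Z_q.
  by rewrite !natrD -Ei -Ej !natrM -!(mulr_natr d%:R); ring.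
rewrite Zp_natr_eq // => /eqP E.
have ij : i = j.
  have /(congr1 (modn^~ d)) := E.
  rewrite /= qE !modn_dvdm ?dvdn_mulr // !(mulnC d) !modnMDl.
  by rewrite !modn_small //; lia.
move/eqP: E; rewrite ij eqn_modDr qE -!muln_modr eqn_mul2l.
by case/orP=> /eqP //; lia.
Qed.

Lemma mem_ball_max q n r (x y : 'rV['Z_q]_n) :
  (y \in ball_max x r) = [forall i, (lee_weight (x 0%R i - y 0%R i)%R <= r)%N].
Proof. by rewrite inE; apply/bigmax_leqP/forallP => h i //; exact: h. Qed.

Lemma mem_ball_max_row_mx q m n r (x x' : 'rV['Z_q]_m) (y y' : 'rV['Z_q]_n) :
  (row_mx x' y' \in ball_max (row_mx x y) r) =
  (x' \in ball_max x r) && (y' \in ball_max y r).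
Proof.
rewrite !mem_ball_max; apply/forallP/andP=> [h|[/forallP hx /forallP hy] i].
  split; apply/forallP=> i; first by have := h (lshift n i); rewrite !row_mxEl.
  by have := h (rshift m i); rewrite !row_mxEr.
by rewrite -(splitK i); case: (split i) => j /=; rewrite ?row_mxEl ?row_mxEr.
Qed.

Lemma mem_ball_max_rV1 q r (x y : 'rV['Z_q]_1) :
  (y \in ball_max x r) = (lee_weight (x 0 0 - y 0 0)%R <= r)%N.
Proof.
rewrite mem_ball_max; apply/forallP/idP => [/(_ 0) //|h i].
by rewrite (ord1 i).
Qed.

Lemma mem_ball_maxD q n r (x y z : 'rV['Z_q]_n) :
  (y \in ball_max (x + z) r) = (y - z \in ball_max x r).
Proof.
rewrite !mem_ball_max; apply: eq_forallb => i.
by rewrite !mxE opprB addrCA addrC addrA.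
Qed.

Lemma ext_codeP q n (C : {set 'rV['Z_q]_n}) (x : 'rV['Z_q]_n) (a : 'Z_q) w :
  reflect (exists c, exists2 k, c \in C &
             w = row_mx (c + x *+ k) (const_mx (a *+ k)))
          (w \in ext_code C x a).
Proof.
have mulrn_row k : row_mx x (const_mx a) *+ k
    = row_mx (x *+ k) (const_mx (a *+ k)) :> 'rV_(n + 1).
  elim: k => [|k IHk]; last by rewrite !mulrS IHk add_row_mx raddfD.
  by rewrite !mulr0n raddf0 row_mx0.
apply: (iffP imset2P) => [[u v /imsetP[c cC ->] /cycleP[k ->] ->]|[c [k cC ->]]].
  by exists c, k; rewrite // FinRing.zmodXgE mulrn_row add_row_mx add0r.
exists (row_mx c 0) (row_mx x (const_mx a) *+ k).
- exact: imset_f.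
- by rewrite -FinRing.zmodXgE mem_cycle.
- by rewrite mulrn_row add_row_mx add0r.
Qed.

Lemma group_set_mulrn q n (C : {set 'rV['Z_q]_n}) c m :
  group_set C -> c \in C -> c *+ m \in C.
Proof. by move=> gC; rewrite -FinRing.zmodXgE; apply: (@groupX _ (group gC)). Qed.

Lemma group_set_ext_code q n (C : {set 'rV['Z_q]_n}) x (a : 'Z_q) :
  group_set C -> group_set (ext_code C x a).
Proof.
move=> /group_setP[C0 CD]; apply/group_setP; split=> [|u v].
  apply/ext_codeP; exists 0, 0%N => //.
  by rewrite !mulr0n addr0 raddf0 row_mx0.
move=> /ext_codeP[c [k cC ->]] /ext_codeP[c' [k' cC' ->]].
apply/ext_codeP; exists (c + c'), (k + k')%N; first exact: CD.
by rewrite FinRing.zmodMgE add_row_mx -raddfD !mulrnDr addrACA.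
Qed.

Lemma leq_card_ext_code q n (C : {set 'rV['Z_q]_n}) x (a : 'Z_q) :
  (#|C| <= #|ext_code C x a|)%N.
Proof.
have inj : injective (fun c => row_mx c 0 : 'rV['Z_q]_(n + 1)).
  by move=> c c' /eq_row_mx[].
rewrite -(card_imset _ inj); apply/subset_leq_card/subsetP=> _ /imsetP[c cC ->].
by apply/ext_codeP; exists c, 0%N; rewrite // !mulr0n addr0 raddf0.
Qed.

(** The condition that [t x] lies in [C] enters here: it lets [C] absorb
    multiples of [t x], which cuts the multiplier [k] down to a residue modulo
    [t]. *)
Lemma ext_code_reduced q n t (C : {set 'rV['Z_q]_n}) x (a : 'Z_q) w :
    (0 < t)%N -> group_set C -> x \in div_code t C -> a *+ t = 0 ->
    w \in ext_code C x a ->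
  exists c k, [/\ c \in C, (k < t)%N &
    w = row_mx (c + x *+ k) (const_mx (a *+ k))].
Proof.
rewrite inE => t0 gC xC at0 /ext_codeP[c [k cC ->]].
have mod_t (V : nmodType) (z : V) : z *+ k = z *+ t *+ (k %/ t) + z *+ (k %% t).
  by rewrite {1}(divn_eq k t) mulrnDr mulnC mulrnA.
exists (c + x *+ t *+ (k %/ t)), (k %% t)%N; split; last 1 first.
- by rewrite -addrA -mod_t (mod_t _ a) at0 mul0rn add0r.
- have /group_setP[_ CD] := gC; apply: CD => //; exact: group_set_mulrn.
- by rewrite ltn_mod.
Qed.

Theorem proposition4p7 (n e t q : nat) (hn : (1 <= n)%N) (ht : (1 < t)%N)
    (hq : q = ((2 * e + 1) * t)%N)
    (C : {set 'rV['Z_q]_n}) (hC : LPL_infty n e q C)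
    (x : 'rV['Z_q]_n) (hx : x \in div_code t C) :
  LPL_infty (n + 1) e q (ext_code C x (2 * e + 1)%N%:R).
Proof.
have q1 : (1 < q)%N by rewrite hq; nia.
have eq : (2 * e < q)%N by rewrite hq; nia.
have t0 : (0 < t)%N := ltnW ht.
have at0 : (2 * e + 1)%N%:R *+ t = 0 :> 'Z_q.
  by rewrite -mulrnA -hq pchar_Zp.
have [gC C1 cover_C pack_C] := hC.
split; first exact: group_set_ext_code.
- exact: leq_trans C1 (leq_card_ext_code _ _ _).
- apply/setP=> w; rewrite inE -(hsubmxK w).
  have [k kw] := lee_weight_cover (rsubmx w 0 0) q1 eq.
  have /bigcupP[c cC cw] : lsubmx w - x *+ k \in \bigcup_(c in C) ball_max c e.
    by rewrite cover_C inE.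
  apply/bigcupP; exists (row_mx (c + x *+ k) (const_mx ((2 * e + 1)%N%:R *+ k))).
    by apply/ext_codeP; exists c, k.
  by rewrite mem_ball_max_row_mx mem_ball_maxD cw mem_ball_max_rV1 mxE.
- move=> u v /(ext_code_reduced t0 gC hx at0)[c [k [cC kt ->]]].
  move=> /(ext_code_reduced t0 gC hx at0)[c' [l [c'C lt ->]]].
  apply: contraR => /pred0Pn[w /andP[/=]].
  rewrite -(hsubmxK w) !mem_ball_max_row_mx !mem_ball_maxD !mem_ball_max_rV1 !mxE.
  move=> /andP[cw kw] /andP[c'w lw].
  have := lee_weight_packing q1 hq t0 kw lw.
  rewrite !modn_small // => kl; subst l.
  have [-> //|/(pack_C _ _ cC c'C)/pred0P/(_ (lsubmx w - x *+ k))] := eqVneq c c'.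
  by rewrite /= cw c'w.
Qed.
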